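(* Let $k$ be a positive integer. (1) For every integer $c\ge 4$ there is an online $c$-coloring algorithm which colors any ordered set of at most $1.22074^{\,c(k-2)+1}$ points in the plane such that throughout the process there is no monochromatic wedge of size $k$. (2) There is $c_0$, not depending on $k$, such that for every integer $c\ge c_0$ there is an online $c$-coloring algorithm which colors any ordered set of at most $1.46557^{\,c(k-2)+1}$ points in the plane such that throughout the process there is no monochromatic wedge of size $k$. (3) There is $c_1$ such that for every integer $c\ge c_1$ there is an online $c$-coloring algorithm which colors any ordered set of at most $1.46557^{\,c}$ points in the plane without ever creating a monochromatic wedge of size $2$.
   Context: A wedge is a set $\{(x,y)\in\mathbb{R}^2 : x<x_0,\ y<y_0\}$ with fixed apex $(x_0,y_0)$, where $x_0=\infty$ and $y_0=\infty$ are also allowed. Given a finite set of colored points in the plane, the size of a wedge is the number of points of the set it contains, and a wedge is monochromatic if all the points of the set it contains have the same color. An online $c$-coloring algorithm is a (deterministic) rule that, when distinct points $p_1,p_2,\ldots$ of the plane arrive one at a time, assigns to $p_i$ on its arrival one of $c$ colors, knowing only $p_1,\ldots,p_i$ and the colors of $p_1,\dots,p_{i-1}$; colors are never changed later and nothing is known about future points. ''Throughout the process'' means: for each $i$, with respect to the colored set $\{p_1,\dots,p_i\}$ right after $p_i$ has been colored. *)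

(* Defs.v *)
From mathcomp Require Import all_boot all_order all_algebra.
From mathcomp Require Import constructive_ereal reals.

Set Implicit Arguments.
Unset Strict Implicit.
Unset Printing Implicit Defensive.

Import Order.TTheory GRing.Theory Num.Theory.
Local Open Scope ring_scope.

(* A finite colored point set, listed in order of arrival. *)
Definition colored (R : realType) (c : nat) : Type := seq ((R * R) * 'I_c).

(* Apex coordinates are reals or +oo; -oo is not allowed. *)
Definition is_wedge (R : realType) (W : pred (R * R)) : Prop :=
  exists x0 y0 : \bar R,
    [/\ x0 != -oo%E, y0 != -oo%E &
        forall p : R * R, W p = ((p.1%:E < x0)%E && (p.2%:E < y0)%E)].

(* The points of s are pairwise distinct wherever this is used, so that
   counting list entries is counting points. *)
Definition wedge_size (R : realType) (c : nat) (s : colored R c)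
    (W : pred (R * R)) : nat :=
  count (fun pc => W pc.1) s.

Definition monochromatic (R : realType) (c : nat) (s : colored R c)
    (W : pred (R * R)) : Prop :=
  forall pc qc, pc \in s -> qc \in s -> W pc.1 -> W qc.1 -> pc.2 = qc.2.

Definition has_mono_wedge (R : realType) (c : nat) (s : colored R c)
    (k : nat) : Prop :=
  exists W : pred (R * R),
    [/\ is_wedge W, wedge_size s W = k & monochromatic s W].

(* An algorithm sees the earlier points with their colors, in order of
   arrival, and the new point. *)
Definition online_alg (R : realType) (c : nat) : Type :=
  colored R c -> R * R -> 'I_c.

Definition run (R : realType) (c : nat) (alg : online_alg R c)
    (ps : seq (R * R)) : colored R c :=
  foldl (fun h p => rcons h (p, alg h p)) [::] ps.

(* Colors are never changed, so the state after the arrival of the i-th point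
   consists of the first i entries of the final coloring. *)
Definition never_mono_wedge (R : realType) (c : nat) (alg : online_alg R c)
    (ps : seq (R * R)) (k : nat) : Prop :=
  forall i : nat, (0 < i <= size ps)%N ->
    ~ has_mono_wedge (take i (run alg ps)) k.

Definition avoids_mono_wedges (R : realType) (c : nat) (alg : online_alg R c)
    (N : R) (k : nat) : Prop :=
  forall ps : seq (R * R), uniq ps -> (size ps)%:R <= N ->
    never_mono_wedge alg ps k.

(* Main.v *)
Require Import Defs.
From mathcomp Require Import all_boot all_order all_algebra.
From mathcomp Require Import constructive_ereal reals.
From mathcomp Require Import zify ring lra.

(** Why the bounds hold.

At any moment let the staircase be the list of minimal points of the current
set for the coordinatewise order, read from left to right.  A wedge that
contains two points of the staircase contains all those in between, so if
neighbouring points of the staircase always have different colours, a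
monochromatic wedge contains exactly one of them ([mono_node_eq]).  The only
thing left to control is then the height of each staircase point [q]: an upper
bound for the size of the monochromatic wedges whose staircase point is [q].

A new point [p] that dominates a staircase point [q] is harmless when its
colour differs from that of [q], since any wedge containing [p] contains [q].
Otherwise [p] joins the staircase, where it replaces the block of the
staircase points that dominate it, between a left neighbour and a right
neighbour.  If [p] avoids the colours of these two neighbours and gets colour
[b], its height is one more than the largest height of colour [b] in the
block, and no other height grows ([extend_staircase]).

The algorithm is greedy: among the colours that are not excluded it takes one
that makes the height of [p] least, ties being broken by a fixed order of the
[c] colours.  This amounts to numbering the pairs (height [f], colour [b]) by
[(f - 1) * c + b], with [0 <= b < c], and choosing the least number ([level]).
To see that large heights are expensive, let every staircase point carry as
its weight one plus the weights of the points that it replaced; the weights on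
the staircase then add up to at most the number of points.  When [p] gets number [m], each
colour that was not excluded would have given a number [j >= m], so if
[j >= c] it occurs in the block with number [j - c]; and different colours
give different [j].  At most two colours are excluded, so if [S m] is the
least weight of a point of number [m], and [S] is 0 at negative numbers,

  [S m >= 1 + S (m - 3) + S (m - 4) + ... + S (m - c)].

Hence [S m >= x ^ (m - 2)] for every [x > 1] with
[x ^ c <= 1 + x + ... + x ^ (c - 3)] ([power_growth], [costly_extend]); such
an [x] is called admissible for [c].  For [c = 4] the condition is
[x ^ 4 <= x + 1], whose root is 1.220744..., and admissibility for [c] implies
it for [c + 1].  As [c] grows, the best [x] tends to the root 1.465571... of
[x ^ 3 = x ^ 2 + 1].  Height [k] means a number at least [c * (k - 1)], hence
at least [x ^ (c * (k - 1) - 2)] points, which is more than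
[x ^ (c * (k - 2) + 1)] since [c >= 4].

For [k = 2] this loses a factor, and the two neighbours have to be counted as
well.  If some point is forced to height 2, then every colour occurs on the
staircase, in the block or at a neighbour; so there are at least
[1 + S 0 + ... + S (c - 1)] points, which is more than [x ^ c]
([heights_le1]). *)

Set Implicit Arguments.
Unset Strict Implicit.
Unset Printing Implicit Defensive.

Import Order.TTheory GRing.Theory Num.Theory.
Local Open Scope ring_scope.

(** * Admissible growth rates *)

(** The recursion for the least weights, with [x ^ m] for [S m] and divided by
    [x ^ (m - c)]. *)
Definition admissible (R : realType) (x : R) (c : nat) : Prop :=
  x ^+ c <= \sum_(i < c - 2) x ^+ i.

Lemma admissible_le (R : realType) (x : R) (b c : nat) :
  0 <= x -> (2 <= b <= c)%N -> admissible x b -> admissible x c.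
Proof.
move=> x0 /andP[b2 /subnK <-]; elim: (c - b)%N => [//|n IHn] /IHn H.
rewrite addSn /admissible subSn; last by rewrite (leq_trans b2) ?leq_addl.
rewrite big_ord_recl expr0 exprS; apply: (@le_trans _ _ (x * \sum_(i < n + b - 2) x ^+ i)).
  by rewrite ler_wpM2l.
rewrite mulr_sumr (eq_bigr (fun i : 'I__ => x ^+ (lift ord0 i))) ?lerDr //.
by move=> i _; rewrite lift0 exprS.
Qed.

Lemma admissible_small (R : realType) (c : nat) :
  (4 <= c)%N -> admissible (122074%:R / 10 ^+ 5 : R) c.
Proof.
move=> c4; apply: (@admissible_le _ _ 4); [lra | lia |].
have : (122074%:R / 10 ^+ 5 : R) ^+ 4 <= 1 + 122074%:R / 10 ^+ 5 by lra.
set x : R := _ / _.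
by rewrite /admissible -[(4 - 2)%N]/2%N big_ord_recr big_ord1.
Qed.

(** Multiplied by [y - 1], the condition for [c = 38] reads
    [1 <= y ^ 36 * (1 + y ^ 2 - y ^ 3)].  The second factor is about [4.3e-6],
    positive because [y] is just below the root of [y ^ 3 = y ^ 2 + 1], and
    [y ^ 2 >= 2] makes the first one at least [2 ^ 18]. *)
Lemma admissible_large (R : realType) (c : nat) :
  (38 <= c)%N -> admissible (146557%:R / 10 ^+ 5 : R) c.
Proof.
move=> c38; apply: (@admissible_le _ _ 38); [lra | lia |].
rewrite /admissible -[(38 - 2)%N]/(2 * 18)%N -[38%N]/(2 * 18 + 2)%N.
have y1 : (0 : R) < 146557%:R / 10 ^+ 5 - 1 by lra.
have y2 : (2 : R) <= (146557%:R / 10 ^+ 5) ^+ 2 by lra.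
have y3 : (4 / 10 ^+ 6 : R) <= 1 + (146557%:R / 10 ^+ 5) ^+ 2 - (146557%:R / 10 ^+ 5) ^+ 3.
  by lra.
move: y1 y2 y3; move: (146557%:R / 10 ^+ 5 : R) => y y1 y2 y3.
rewrite -(ler_pM2l y1) -subrX1 exprD.
have : (2 : R) ^+ 18 <= y ^+ (2 * 18) by rewrite exprM lerXn2r ?nnegrE //; lra.
set Y := y ^+ (2 * 18) => Y18.
have : (4 / 10 ^+ 6) * Y <= (1 + y ^+ 2 - y ^+ 3) * Y by rewrite ler_wpM2r //; lra.
by lra.
Qed.

Section Growth.
Context (R : realType) (c : nat) (x : R).
Hypotheses (x1 : 1 < x) (xc : admissible x c).

Let x0 : 0 < x. Proof. exact: lt_trans x1. Qed.

(** The limit form of admissibility, [x ^ 3 < x ^ 2 + 1]: multiply [xc] by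
    [x - 1] and drop the term [-1]. *)
Lemma base_cubic : (1 < c)%N -> x ^+ 2 * (x - 1) < 1.
Proof.
move=> c2; have xc2 : 0 < x ^+ (c - 2) by rewrite exprn_gt0.
have : (x - 1) * x ^+ c <= x ^+ (c - 2) - 1.
  by rewrite subrX1 ler_pM2l ?subr_gt0.
rewrite -{1}(subnK c2) exprD => H.
rewrite -(ltr_pM2l xc2) mulr1.
by set X := x ^+ (c - 2) in H *; lra.
Qed.

(** If a colour would put the new point at number [j], it already occurs in the
    replaced block exactly when [c <= j], and then at number [j - c]; this is
    the weight that such an occurrence guarantees. *)
Definition shifted (j : nat) : R := if (c <= j)%N then x ^+ (j - c) else 0.

Lemma shifted_ge0 j : 0 <= shifted j.
Proof. by rewrite /shifted; case: ifP => // _; rewrite exprn_ge0 // ltW. Qed.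

Lemma shifted_homo : {homo shifted : i j / (i <= j)%N >-> i <= j}.
Proof.
move=> i j ij; rewrite {1}/shifted; case: leqP => [ci|_]; last exact: shifted_ge0.
by rewrite /shifted (leq_trans ci ij) ler_weXn2l ?(ltW x1)// leq_sub2r.
Qed.

(** One step of the recursion.  For [c <= m] it is admissibility times
    [x ^ (m - c)].  For [m < c] the sum is truncated to [m - 2] terms, and a
    geometric sum together with [base_cubic] gives the bound; the initial
    values, up to [m = 2], are covered by the constant [x ^ 2]. *)
Lemma power_growth m :
  (1 < c)%N -> x ^+ m <= x ^+ 2 + \sum_(i < c - 2) shifted (m + i).
Proof.
move=> c1; case: (leqP c m) => [cm|mc].
  rewrite (@le_trans _ _ (\sum_(i < c - 2) shifted (m + i))) ?lerDr ?exprn_ge0 ?(ltW x0)//.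
  have -> : \sum_(i < c - 2) shifted (m + i) = x ^+ (m - c) * \sum_(i < c - 2) x ^+ i.
    rewrite mulr_sumr; apply: eq_bigr => i _.
    by rewrite /shifted (leq_trans cm (leq_addr _ _)) -exprD addnBAC.
  by rewrite -{1}(subnK cm) exprD ler_pM2l ?exprn_gt0.
case: (leqP m 2) => [m2|m2].
  rewrite (@le_trans _ _ (x ^+ 2)) ?ler_weXn2l ?(ltW x1)// lerDl.
  by apply: sumr_ge0 => i _; apply: shifted_ge0.
(* The first [c - m] terms vanish, and the others start with [x ^ 0]. *)
have -> : \sum_(i < c - 2) shifted (m + i) = \sum_(i < m - 2) x ^+ i.
  rewrite -!(big_mkord xpredT (fun i => shifted (m + i))).
  rewrite (@big_cat_nat _ _ _ (c - m)%N) ?leq_sub2l//=; last lia.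
  rewrite [X in X + _]big1_seq ?add0r; last first.
    move=> i; rewrite mem_index_iota => /andP[_ ic].
    by rewrite /shifted ifN //; lia.
  rewrite -{1}[(c - m)%N]add0n big_addn -(big_mkord xpredT (fun i => x ^+ i)).
  have -> : (c - 2 - (c - m) = m - 2)%N by lia.
  apply: eq_big_nat => i _; rewrite /shifted ifT; last lia.
  by congr (_ ^+ _); lia.
have S := subrX1 x (m - 2); have b := base_cubic c1.
have xm : 1 <= x ^+ (m - 2) by rewrite exprn_ege1 ?ltW.
have -> : x ^+ m = x ^+ 2 * x ^+ (m - 2) by rewrite -exprD subnKC // ltnW.
set X := x ^+ (m - 2) in S xm *; set T := \sum_(i < _) _ in S *.
have T0 : 0 <= T by apply: sumr_ge0 => i _; rewrite exprn_ge0 ?ltW.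
have -> : X = 1 + (x - 1) * T by rewrite -S; ring.
have : x ^+ 2 * (x - 1) * T <= 1 * T by rewrite ler_wpM2r // ltW.
by lra.
Qed.

End Growth.

(** The [n]-th of [n] distinct integers that are at least [m] is at least
    [m + n - 1]. *)
Lemma sum_uniq_ge (R : realType) (v : nat -> R) (m n : nat) (t : seq nat) :
  (forall j, 0 <= v j) -> {homo v : i j / (i <= j)%N >-> i <= j} ->
  uniq t -> all (leq m) t -> (n <= size t)%N ->
  \sum_(i < n) v (m + i)%N <= \sum_(j <- t) v j.
Proof.
move=> v0 vle; elim: n t => [|n IHn] t ut mt nt.
  by rewrite big_ord0; apply: sumr_ge0.
have /hasP[j jt jn] : has (leq (m + n)) t.
  rewrite -[has _ _]negbK -all_predC; apply/negP => /allP tlt.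
  have : (size t <= size (iota m n))%N.
    apply: uniq_leq_size ut _ => i it; rewrite mem_iota (allP mt _ it) /=.
    by have := tlt i it; rewrite /= -ltnNge.
  by rewrite size_iota; lia.
rewrite big_ord_recr /= (big_rem j) //= addrC lerD ?vle//.
apply: IHn; first exact: rem_uniq.
  by apply/allP => i /mem_rem/(allP mt).
by rewrite size_rem //; move: nt; case: (size t).
Qed.

(** * The staircase of minimal points *)

Section Staircase.
Context (R : realType) (c : nat).

(** A tuple rather than a record, so that nodes inherit decidable equality. *)
Definition node : Type := ((R * R) * 'I_c) * (nat * nat).
Definition pos (q : node) : R * R := q.1.1.
Definition hue (q : node) : 'I_c := q.1.2.
Definition height (q : node) : nat := q.2.1.
Definition weight (q : node) : nat := q.2.2.

Definition below (q p : R * R) : bool := (q.1 <= p.1) && (q.2 <= p.2).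

Definition left_part (p : R * R) (s : seq node) : seq node :=
  [seq q <- s | (pos q).1 < p.1].
Definition above_part (p : R * R) (s : seq node) : seq node :=
  [seq q <- s | below p (pos q)].
Definition right_part (p : R * R) (s : seq node) : seq node :=
  [seq q <- s | (pos q).2 < p.2].

Definition hue_height (s : seq node) (b : 'I_c) : nat :=
  (\max_(q <- s | hue q == b) height q)%N.
Definition total_weight (s : seq node) : nat :=
  (\sum_(q <- s) weight q)%N.

Definition new_node (s : seq node) (p : R * R) (a : 'I_c) : node :=
  let M := above_part p s in
  ((p, a), ((hue_height M a).+1, (total_weight M).+1)).

Definition extend (s : seq node) (p : R * R) (a : 'I_c) : seq node :=
  if has (fun q => below (pos q) p) s then s
  else left_part p s ++ new_node s p a :: right_part p s.

Definition staircase (h : colored R c) : seq node :=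
  foldl (fun s pc => extend s pc.1 pc.2) [::] h.

Definition southeast (q t : node) : bool :=
  ((pos q).1 < (pos t).1) && ((pos t).2 < (pos q).2).
Definition differ (q t : node) : bool := hue q != hue t.

Lemma right_part_all (p : R * R) (x : node) (s : seq node) :
  (pos x).2 < p.2 -> all (southeast x) s ->
  all (fun q => (pos q).2 < p.2) s.
Proof.
move=> xp /allP xs; apply/allP => y /xs /andP[_ yx]; exact: lt_trans yx xp.
Qed.

(** Left of [p], dominating [p], right of [p]: along the staircase these occur
    in this order, so the three filters cut it into consecutive pieces. *)
Lemma staircase_split (p : R * R) (s : seq node) :
  pairwise southeast s -> ~~ has (fun q => below (pos q) p) s ->
  s = left_part p s ++ above_part p s ++ right_part p s.
Proof.
rewrite /left_part /above_part /right_part.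
elim: s => [//|x s IHs] /=.
case/andP=> xs ps; rewrite negb_or => /andP[xp sp].
have {}IHs := IHs ps sp.
have leftE : (p.1 <= (pos x).1) -> [seq q <- s | (pos q).1 < p.1] = [::].
  move=> px; apply/eqP; rewrite -[_ == _]negbK -has_filter.
  apply/hasPn => y /(allP xs) /andP[xy _] /=.
  by rewrite -leNgt (le_trans px (ltW xy)).
move: xp; rewrite /below negb_and -!ltNge.
case: (ltP (pos x).1 p.1) => [x1 /=|px1 _].
  rewrite ltNge (ltW x1) /= => px2.
  by rewrite ltNge (ltW px2) /= -IHs.
rewrite (leftE px1) /= in IHs *.
case: (ltP (pos x).2 p.2) => [x2 /=|px2].
  have /all_filterP E := right_part_all x2 xs.
  rewrite E; suff -> : [seq q <- s | below p (pos q)] = [::] by [].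
  apply/eqP; rewrite -[_ == _]negbK -has_filter.
  apply/hasPn => y /(allP xs) /andP[_ yx] /=.
  by rewrite /below negb_and -!ltNge (lt_trans yx x2) orbT.
by rewrite /= -IHs.
Qed.

Lemma total_weight_extend (s : seq node) (p : R * R) (a : 'I_c) :
  pairwise southeast s -> ~~ has (fun q => below (pos q) p) s ->
  total_weight (extend s p a) = (total_weight s).+1.
Proof.
move=> ps dom; rewrite /extend (negPf dom) [in RHS](staircase_split ps dom).
rewrite /total_weight !big_cat big_cons /= /weight /= -/(total_weight _).
by rewrite /total_weight addSn !addnS.
Qed.

(** * Monochromatic wedges meet the staircase in one point *)

(** These sets are the products of two sets of reals closed downwards.  Taking
    [u = v] gives closure under domination; [u] right of [v] on the staircase
    gives every staircase point in between. *)
Definition corner_closed (W : pred (R * R)) : Prop :=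
  forall u v r : R * R, W u -> W v -> r.1 <= u.1 -> r.2 <= v.2 -> W r.

Lemma wedge_corner_closed (W : pred (R * R)) :
  is_wedge W -> corner_closed W.
Proof.
case=> x0 [y0 [_ _ WE]] u v r; rewrite !WE => /andP[u1 _] /andP[_ v2] r1 r2.
by rewrite (le_lt_trans _ u1) ?lee_fin// (le_lt_trans _ v2) ?lee_fin.
Qed.

Lemma corner_closed_below (W : pred (R * R)) (q p : R * R) :
  corner_closed W -> below q p -> W p -> W q.
Proof. by move=> Wc /andP[q1 q2] Wp; exact: (Wc p p). Qed.

(** Two nodes in [W] would force two neighbouring ones in [W], which have
    different hues. *)
Lemma mono_unique_node (W : pred (R * R)) (s : seq node) :
  corner_closed W -> pairwise southeast s -> sorted differ s ->
  (forall q t, q \in s -> t \in s -> W (pos q) -> W (pos t) -> hue q = hue t) ->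
  (count (fun q => W (pos q)) s <= 1)%N.
Proof.
move=> Wc; elim: s => [//|x s IHs] /= /andP[xs ps] ds mono.
have {}IHs : (count (fun q => W (pos q)) s <= 1)%N.
  apply: IHs ps (path_sorted ds) _ => q t qs ts.
  by apply: mono; rewrite inE ?qs ?ts orbT.
case Wx : (W (pos x)) => //=; rewrite add1n ltnS leqn0 -leqn0 leqNgt -has_count.
apply/hasPn => t ts; apply/negP => Wt.
case: s => [//|y s] /= in xs ps ds mono ts {IHs} *.
have Wy : W (pos y).
  apply: (Wc (pos t) (pos x)) => //.
    move: ts; rewrite inE => /predU1P[->//|ts].
    by case/andP: ps => /allP/(_ t ts)/andP[/ltW].
  by case/andP: xs => /andP[_ /ltW].
case/andP: ds => /eqP[]; apply: mono => //; by rewrite !inE eqxx ?orbT.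
Qed.

Lemma mono_node_eq (h : colored R c) (W : pred (R * R)) (s : seq node) q t :
  corner_closed W -> pairwise southeast s -> sorted differ s ->
  (forall q, q \in s -> q.1 \in h) -> monochromatic h W ->
  q \in s -> t \in s -> W (pos q) -> W (pos t) -> q = t.
Proof.
move=> Wc ps ds sh mono qs ts Wq Wt.
have := mono_unique_node Wc ps ds.
have H : forall q t, q \in s -> t \in s -> W (pos q) -> W (pos t) -> hue q = hue t.
  by move=> u v us vs Wu Wv; apply: (mono u.1 v.1); rewrite ?sh.
move=> /(_ H) {H}; rewrite -size_filter.
have: q \in [seq q <- s | W (pos q)] by rewrite mem_filter Wq.
have: t \in [seq q <- s | W (pos q)] by rewrite mem_filter Wt.
by case: [seq _ <- _ | _] => [//|u [|//]]; rewrite !inE => /eqP-> /eqP->.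
Qed.

(** The invariant of the process: it survives the arrival of any point whose
    colour is not blocked, however the colour is chosen otherwise, and bounds
    monochromatic wedges by heights. *)
Record staircase_of (h : colored R c) (s : seq node) : Prop := StaircaseOf {
  stair_sorted : pairwise southeast s;
  stair_differ : sorted differ s;
  stair_mem : forall q, q \in s -> q.1 \in h;
  stair_below : forall z, z \in h -> has (fun q => below (pos q) z.1) s;
  stair_height : forall W, corner_closed W -> monochromatic h W ->
    forall q, q \in s -> W (pos q) -> (wedge_size h W <= height q)%N;
  stair_weight : (total_weight s <= size h)%N
}.

Lemma mono_rcons (h : colored R c) (W : pred (R * R)) z :
  monochromatic (rcons h z) W -> monochromatic h W.
Proof.
by move=> mono u v uh vh; apply: mono; rewrite mem_rcons inE ?uh ?vh orbT.
Qed.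

Lemma wedge_size_rcons (h : colored R c) (W : pred (R * R)) z :
  wedge_size (rcons h z) W = (wedge_size h W + W z.1)%N.
Proof. by rewrite /wedge_size -cats1 count_cat /= addn0. Qed.

Lemma mono_size_bounded (h : colored R c) (s : seq node) (k : nat) :
  staircase_of h s -> (0 < k)%N ->
  (forall q, q \in s -> (height q < k)%N) -> ~ has_mono_wedge h k.
Proof.
move=> [ps ds sh hs hgt _] k0 hk [W [/wedge_corner_closed Wc Wk mono]].
move: (k0); rewrite -Wk -has_count => /hasP[z /hs /hasP[t ts tz] Wz].
have := hgt W Wc mono t ts (corner_closed_below Wc tz Wz).
by rewrite Wk leqNgt hk.
Qed.

(** * Arrival of a point *)

(** For a point that dominates part of the staircase it is enough to avoid the
    colour of one of the dominated nodes; a point that enters the staircase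
    has to differ from its future neighbours, the last node on its left and
    the first one on its right. *)
Definition blocked (s : seq node) (p : R * R) : seq 'I_c :=
  if [seq q <- s | below (pos q) p] is q :: _ then [:: hue q]
  else map hue (take 1 (rev (left_part p s)) ++ take 1 (right_part p s)).

Lemma size_blocked (s : seq node) (p : R * R) : (size (blocked s p) <= 2)%N.
Proof.
rewrite /blocked; case: [seq _ <- _ | _] => //=.
rewrite size_map size_cat !size_take.
by case: ifP; case: ifP; lia.
Qed.

(** A monochromatic wedge cannot contain the new point, since with it comes a
    dominated node of another hue. *)
Lemma extend_dominating (h : colored R c) (s : seq node) (p : R * R) (a : 'I_c) :
  staircase_of h s -> a \notin blocked s p ->
  has (fun q => below (pos q) p) s ->
  staircase_of (rcons h (p, a)) s.
Proof.
case=> ps ds sh hs hgt wgt ab dom; split=> //.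
- by move=> q /sh qh; rewrite mem_rcons inE qh orbT.
- by move=> z; rewrite mem_rcons inE => /predU1P[->|/hs].
- move=> W Wc mono q qs Wq.
  rewrite wedge_size_rcons /=.
  suff /negPf-> : ~~ W p.
    by rewrite addn0; apply: hgt => //; apply: mono_rcons mono.
  apply/negP => Wp; move: ab; rewrite /blocked.
  case E : [seq _ <- _ | _] => [|t s'].
    by move: dom; rewrite has_filter E.
  have : t \in [seq q <- s | below (pos q) p] by rewrite E inE eqxx.
  rewrite mem_filter => /andP[tp ts]; rewrite inE => /eqP[].
  apply: (mono (p, a) t.1); rewrite ?mem_rcons ?inE ?eqxx ?sh ?orbT//.
  exact: (corner_closed_below Wc tp).
- by rewrite size_rcons (leq_trans wgt).
Qed.

(** A monochromatic wedge [W] contains just one node [q] of the new staircase.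
    If [q] is the new node, the nodes of the old staircase in [W] dominate [p],
    so the height of one of them, of the same hue, bounds the number of older
    points in [W], unless there are none;
    otherwise [W] does not contain [p] and the old bound applies. *)
Lemma extend_minimal (h : colored R c) (s : seq node) (p : R * R) (a : 'I_c) :
  staircase_of h s -> a \notin blocked s p ->
  ~~ has (fun q => below (pos q) p) s ->
  staircase_of (rcons h (p, a)) (extend s p a).
Proof.
move=> [ps ds sh hs hgt wgt] ab dom.
have TW := total_weight_extend a ps dom.
have sE := staircase_split ps dom.
have split3 t : t \in s ->
    [|| t \in left_part p s, t \in above_part p s | t \in right_part p s].
  by move=> ts; rewrite -!mem_cat -sE.
rewrite /extend (negPf dom) in TW *.
have LtoP t : t \in left_part p s -> t \in s /\ southeast t (new_node s p a).
  rewrite mem_filter => /andP[tp ts]; split=> //; rewrite /southeast tp /=.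
  by move/hasPn/(_ t ts): dom; rewrite /below /pos (ltW tp) /= -ltNge.
have RtoP t : t \in right_part p s -> t \in s /\ southeast (new_node s p a) t.
  rewrite mem_filter => /andP[tp ts]; split=> //; rewrite /southeast tp andbT /=.
  by move/hasPn/(_ t ts): dom; rewrite /below /pos (ltW tp) andbT -ltNge.
have ps' : pairwise southeast (left_part p s ++ new_node s p a :: right_part p s).
  move: ps; rewrite [in X in X -> _]sE !pairwise_cat allrel_catr => /and3P[].
  move=> /andP[_ LR] pL /and3P[_ _ pR]; rewrite /= pL pR allrel_consr LR /= !andbT.
  by apply/andP; split; apply/allP => t; [case/LtoP|case/RtoP].
have ds' : sorted differ (left_part p s ++ new_node s p a :: right_part p s).
  move: ds; rewrite [in X in X -> _]sE => ds.
  have [dL /cat_sorted2[_ dR]] := cat_sorted2 ds.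
  rewrite sorted_cat_cons; move: ab; rewrite /blocked.
  move: dom; rewrite has_filter negbK => /eqP->.
  rewrite map_cat mem_cat negb_or => /andP[aL aR]; apply/andP; split.
    case/lastP: (left_part p s) dL aL => [//|L l] dL.
    rewrite rev_rcons /= take0 /= inE => al.
    by rewrite -cats1 cat_rcons sorted_cat_cons dL /= /differ eq_sym al.
  case: (right_part p s) dR aR => [//|r R'] /= dR.
  by rewrite take0 inE => ar; rewrite /differ ar.
have sh' q : q \in left_part p s ++ new_node s p a :: right_part p s ->
    q.1 \in rcons h (p, a).
  rewrite mem_cat inE mem_rcons inE => /or3P[/LtoP[/sh->]|/eqP->|/RtoP[/sh->]];
    by rewrite ?orbT ?eqxx.
split=> //; last by rewrite size_rcons TW ltnS.
- move=> z; rewrite mem_rcons inE => /predU1P[->|/hs/hasP[t ts tz]].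
    by apply/hasP; exists (new_node s p a); rewrite ?mem_cat ?inE ?eqxx ?orbT /below ?lexx.
  have /or3P[tL|tM|tR] := split3 _ ts.
  + by apply/hasP; exists t => //; rewrite mem_cat tL.
  + apply/hasP; exists (new_node s p a); first by rewrite mem_cat inE eqxx orbT.
    move: tM tz; rewrite mem_filter /below => /andP[/andP[p1 p2] _] /andP[t1 t2].
    by rewrite (le_trans p1 t1) (le_trans p2 t2).
  + by apply/hasP; exists t => //; rewrite mem_cat inE tR !orbT.
- move=> W Wc mono q qs Wq; rewrite wedge_size_rcons /=.
  have uniqN := mono_node_eq Wc ps' ds' sh' mono.
  have monoh := mono_rcons mono.
  have Ns : new_node s p a \in left_part p s ++ new_node s p a :: right_part p s.
    by rewrite mem_cat inE eqxx orbT.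
  have [Wp|/negPf nWp] := boolP (W p); last first.
    rewrite addn0; apply: hgt => //.
    move: qs; rewrite mem_cat inE => /or3P[/LtoP[]//|/eqP qE|/RtoP[]//].
    by move: Wq; rewrite qE /pos /= nWp.
  have -> : q = new_node s p a by apply: uniqN.
  rewrite addn1 ltnS.
  case: (posnP (wedge_size h W)) => [->//|]; rewrite -has_count => /hasP[z zh Wz].
  have /hasP[t ts tz] := hs _ zh.
  have Wt := corner_closed_below Wc tz Wz.
  have tM : t \in above_part p s.
    have tN : t \in left_part p s ++ new_node s p a :: right_part p s -> t = new_node s p a.
      by move=> tN; apply: uniqN.
    have /or3P[tL|//|tR] := split3 _ ts.
      have /LtoP[_] := tL; rewrite (tN _) ?mem_cat ?tL// /southeast.
      by rewrite ltxx.
    have /RtoP[_] := tR; rewrite (tN _) ?mem_cat ?inE ?tR ?orbT// /southeast.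
    by rewrite ltxx.
  apply: (leq_trans (hgt W Wc monoh t ts Wt)).
  rewrite /hue_height; apply: leq_bigmax_seq => //.
  apply/eqP; apply: (mono t.1 (p, a)) => //; rewrite mem_rcons inE ?eqxx//.
  by rewrite sh ?orbT.
Qed.

Lemma extend_staircase (h : colored R c) (s : seq node) (p : R * R) (a : 'I_c) :
  staircase_of h s -> a \notin blocked s p ->
  staircase_of (rcons h (p, a)) (extend s p a).
Proof.
move=> hs ab; have [dom|ndom] := boolP (has (fun q => below (pos q) p) s).
  by rewrite /extend dom; exact: extend_dominating.
exact: extend_minimal.
Qed.

(** * The greedy algorithm *)

(** The number of the pair (height, hue) that a new node replacing the block [s]
    would get with hue [b]: heights are compared first, then hues. *)
Definition level (s : seq node) (b : 'I_c) : nat := (hue_height s b * c + b)%N.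

Lemma level_inj (s : seq node) : injective (level s).
Proof.
move=> a b /(congr1 (modn^~ c)); rewrite /level /= !modnMDl !modn_small //.
exact: val_inj.
Qed.

(** Three colours are enough for some colour to be unblocked, and then the
    default [a0] is not taken. *)
Definition greedy_hue (a0 : 'I_c) (s : seq node) (p : R * R) : 'I_c :=
  [arg min_(b < odflt a0 [pick b | b \notin blocked s p]
            | b \notin blocked s p) level (above_part p s) b].

Definition greedy (a0 : 'I_c) : online_alg R c :=
  fun h p => greedy_hue a0 (staircase h) p.

Lemma greedy_hueP (a0 : 'I_c) (s : seq node) (p : R * R) :
  (2 < c)%N ->
  greedy_hue a0 s p \notin blocked s p /\
  forall b, b \notin blocked s p ->
    (level (above_part p s) (greedy_hue a0 s p) <= level (above_part p s) b)%N.
Proof.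
move=> c2; rewrite /greedy_hue; case: arg_minnP => [|a ab amin]; last first.
  by split.
(* The starting point of the minimum has to be unblocked itself. *)
case: pickP => [//|allb] /=; exfalso.
have : (c <= size (blocked s p))%N.
  rewrite -{1}(card_ord c) cardE; apply: uniq_leq_size; first exact: enum_uniq.
  by move=> b _; move/negbT: (allb b); rewrite negbK.
by have := size_blocked s p; lia.
Qed.

Lemma staircase_rcons (h : colored R c) (z : (R * R) * 'I_c) :
  staircase (rcons h z) = extend (staircase h) z.1 z.2.
Proof. by rewrite /staircase -cats1 foldl_cat. Qed.

Lemma run_rcons (alg : online_alg R c) ps p :
  run alg (rcons ps p) = rcons (run alg ps) (p, alg (run alg ps) p).
Proof. by rewrite /run -cats1 foldl_cat. Qed.

Lemma size_run (alg : online_alg R c) ps : size (run alg ps) = size ps.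
Proof. by elim/last_ind: ps => [//|ps p IH]; rewrite run_rcons !size_rcons IH. Qed.

Lemma take_run (alg : online_alg R c) ps i :
  take i (run alg ps) = run alg (take i ps).
Proof.
elim/last_ind: ps => [|ps p IH]; first by rewrite /run /=.
rewrite run_rcons -!cats1 !take_cat size_run IH; case: ltnP => [//|il].
case: (i - size ps)%N => [|n]; first by rewrite !cats0.
by rewrite /= !cats1 run_rcons.
Qed.

Lemma greedy_staircase (a0 : 'I_c) ps :
  (2 < c)%N ->
  staircase_of (run (greedy a0) ps) (staircase (run (greedy a0) ps)).
Proof.
move=> c2; elim/last_ind: ps => [|ps p IH].
  split => //; rewrite /total_weight /staircase /run /= big_nil //.
rewrite run_rcons staircase_rcons; apply: extend_staircase => //=.
by have [] := greedy_hueP a0 (staircase (run (greedy a0) ps)) p c2.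
Qed.

Lemma never_mono_wedge_heights (a0 : 'I_c) ps k :
  (2 < c)%N -> (0 < k)%N ->
  (forall i q, q \in staircase (run (greedy a0) (take i ps)) -> (height q < k)%N) ->
  never_mono_wedge (greedy a0) ps k.
Proof.
move=> c2 k0 hk i _; rewrite take_run.
exact: mono_size_bounded (greedy_staircase a0 _ c2) k0 (hk i).
Qed.

(** * High points are costly *)

Lemma hue_height_attained (s : seq node) (b : 'I_c) :
  (0 < hue_height s b)%N ->
  exists q, [/\ q \in s, hue q = b & height q = hue_height s b].
Proof.
rewrite /hue_height; elim: s => [|q s IHs]; first by rewrite big_nil.
rewrite big_cons; case: (eqVneq (hue q) b) => [qb|_] m0; last first.
  by have [t [ts tb th]] := IHs m0; exists t; rewrite inE ts orbT.
case: (leqP (height q) (\max_(t <- s | hue t == b) height t)) => [le|lt].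
  move: m0; rewrite (maxn_idPr le) => m0.
  by have [t [ts tb th]] := IHs m0; exists t; rewrite inE ts orbT.
by exists q; rewrite inE eqxx.
Qed.

Lemma count_unblocked (s : seq node) (p : R * R) :
  (c - 2 <= #|[pred b | b \notin blocked s p]|)%N.
Proof.
rewrite leq_subLR -[leqLHS](card_ord c) -(cardC (mem (blocked s p))) leq_add //.
exact: leq_trans (card_size _) (size_blocked _ _).
Qed.

(** Nodes that represent different hues are different. *)
Lemma sum_hues_le (A : pred 'I_c) (u : 'I_c -> R) (s : seq node) (v : node -> R) :
  (forall q, 0 <= v q) ->
  (forall b, A b -> exists q, [/\ q \in s, hue q = b & u b <= v q]) ->
  \sum_(b | A b) u b <= \sum_(q <- s) v q.
Proof.
move=> v0 uv; rewrite (partition_big hue predT) //=.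
rewrite [leRHS](bigID A) /= -[leLHS]addr0 lerD //; last first.
  by apply: sumr_ge0 => b _; apply: sumr_ge0.
apply: ler_sum => b /uv[q [qs qb]] /le_trans; apply.
rewrite (big_rem q) //= qb eqxx lerDl; exact: sumr_ge0.
Qed.

Section Cost.
Context (x : R).
Hypotheses (x1 : 1 < x) (xc : admissible x c).

Let x0 : 0 < x. Proof. exact: lt_trans x1. Qed.

(** The bound [S m >= x ^ (m - 2)] at [m = (height - 1) * c + hue]; multiplying
    by [x ^ 2] keeps the exponents natural. *)
Definition costly (s : seq node) : Prop := forall q, q \in s ->
  (0 < height q)%N /\ x ^+ ((height q).-1 * c + hue q) <= x ^+ 2 * (weight q)%:R.

Lemma costly_sum (s : seq node) (A : pred 'I_c) (u : 'I_c -> R) :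
  (forall b, A b -> exists q, [/\ q \in s, hue q = b & u b <= x ^+ 2 * (weight q)%:R]) ->
  \sum_(b | A b) u b <= x ^+ 2 * (total_weight s)%:R.
Proof.
move=> H; rewrite /total_weight natr_sum mulr_sumr; apply: sum_hues_le => // q.
by rewrite mulr_ge0 ?exprn_ge0 ?(ltW x0).
Qed.

(** Every hue that is not blocked has a level at least that of the chosen one,
    and these levels are distinct; so the hues among them that occur in the
    replaced block carry together at least the sum in [power_growth]. *)
Lemma costly_extend (s : seq node) (p : R * R) (a0 : 'I_c) :
  (2 < c)%N -> costly s -> costly (extend s p (greedy_hue a0 s p)).
Proof.
move=> c2 cs q; rewrite /extend; case: ifP => [_|_]; first exact: cs.
rewrite mem_cat inE => /or3P[|/eqP->|]; rewrite ?mem_filter; try by case/andP => _ /cs.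
have [ab amin] := greedy_hueP a0 s p c2.
set a := greedy_hue a0 s p in ab amin *; set M := above_part p s in amin *.
split=> //; rewrite /height /weight /hue /= -/M -/(level M a).
apply: le_trans (power_growth x1 xc _ (ltnW c2)) _.
rewrite -natr1 mulrDr mulr1 addrC lerD2r.
apply: (@le_trans _ _ (\sum_(b | b \notin blocked s p) shifted c x (level M b))).
  have <- : \sum_(j <- image (level M) [pred b | b \notin blocked s p]) shifted c x j
      = \sum_(b | b \notin blocked s p) shifted c x (level M b) by rewrite big_image.
  apply: sum_uniq_ge (shifted_ge0 c x1) (shifted_homo c x1) _ _ _.
  - rewrite map_inj_uniq ?enum_uniq //; exact: level_inj.
  - by apply/allP => _ /imageP[b bb ->]; exact: amin.
  - by rewrite size_map -cardE count_unblocked.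
rewrite /shifted -big_mkcondr /=.
apply: costly_sum => b /andP[_ cl].
have : (0 < hue_height M b)%N.
  by move: cl; rewrite /level; case: (hue_height M b) => //; rewrite mul0n leqNgt ltn_ord.
case/hue_height_attained => t [tM tb th]; exists t; split=> //.
have [t0] := cs t (mem_subseq (filter_subseq _ _) tM); apply: le_trans.
rewrite ler_weXn2l ?(ltW x1)// tb /level -th.
by case: (height t) t0 => [//|f] _; rewrite mulSn /=; lia.
Qed.

Lemma costly_run (a0 : 'I_c) (ps : seq (R * R)) :
  (2 < c)%N -> costly (staircase (run (greedy a0) ps)).
Proof.
move=> c2; elim/last_ind: ps => [//|ps p IH].
by rewrite run_rcons staircase_rcons; exact: costly_extend.
Qed.

Lemma weight_le_total (q : node) (s : seq node) :
  q \in s -> (weight q <= total_weight s)%N.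
Proof. by move=> qs; rewrite /total_weight (big_rem q) //= leq_addr. Qed.

(** A node of height above [k] has level at least [c * k]. *)
Lemma greedy_avoids (a0 : 'I_c) (N : R) (k : nat) :
  (2 < c)%N -> N * x ^+ 2 < x ^+ (c * k) -> avoids_mono_wedges (greedy a0) N k.+1.
Proof.
move=> c2 Nk ps _ psN; apply: never_mono_wedge_heights => // i q qs.
rewrite ltnS leqNgt; apply/negP => kq; move: Nk; apply/negP; rewrite -leNgt.
have [_ cq] := costly_run c2 qs.
apply: (@le_trans _ _ (x ^+ 2 * (weight q)%:R)).
  apply: le_trans cq; rewrite ler_weXn2l ?(ltW x1)// (leq_trans _ (leq_addr _ _)) //.
  by rewrite mulnC leq_mul2r -ltnS prednK ?kq ?orbT // (leq_ltn_trans _ kq).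
rewrite mulrC ler_pM2r ?exprn_gt0 // (le_trans _ psN) // ler_nat.
apply: leq_trans (weight_le_total qs) _.
apply: leq_trans (stair_weight (greedy_staircase a0 _ c2)) _.
by rewrite size_run size_take; case: ltnP => // /ltnW.
Qed.

(** If the greedy choice has height at least 2, every unblocked hue occurs in
    the replaced block, and a blocked hue occurs at a neighbour.  So all hues
    occur on the staircase, whose total weight is then at least
    [(1 + x + ... + x ^ (c - 1)) / x ^ 2]; by [base_cubic] this exceeds
    [x ^ c - 1], an upper bound for the number of earlier points. *)
Lemma heights_le1 (a0 : 'I_c) (ps : seq (R * R)) :
  (2 < c)%N -> (size ps)%:R <= x ^+ c ->
  forall q, q \in staircase (run (greedy a0) ps) -> (height q <= 1)%N.
Proof.
move=> c2; elim/last_ind: ps => [//|ps p IH]; rewrite size_rcons => psN.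
have {}IH : forall q, q \in staircase (run (greedy a0) ps) -> (height q <= 1)%N.
  by apply: IH; apply: le_trans psN; rewrite ler_nat.
rewrite run_rcons staircase_rcons /= /greedy -/(greedy a0).
have cs := costly_run (a0 := a0) (ps := ps) c2.
have := stair_weight (greedy_staircase a0 ps c2); rewrite size_run.
set s := staircase _ in IH cs * => ws q.
rewrite /extend; case: ifP => [_|/negbT dom]; first exact: IH.
rewrite mem_cat inE => /or3P[|/eqP->|]; rewrite ?mem_filter; try by case/andP => _ /IH.
have [ab amin] := greedy_hueP a0 s p c2.
set a := greedy_hue a0 s p in ab amin *; set M := above_part p s in amin *.
rewrite /height /= -/M ltnS leqNgt; apply/negP => ha.
have every_hue b : exists q, [/\ q \in s, hue q = b & x ^+ b <= x ^+ 2 * (weight q)%:R].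
  suff [t ts tb] : exists2 t, t \in s & hue t = b.
    exists t; split=> //; have [_] := cs t ts; apply: le_trans.
    by rewrite ler_weXn2l ?(ltW x1)// tb leq_addl.
  have [bb|/amin] := boolP (b \in blocked s p).
    move: bb; rewrite /blocked; move: dom; rewrite has_filter negbK => /eqP->.
    case/mapP => t; rewrite mem_cat => tLR ->; exists t => //.
    by case/orP: tLR => /mem_take; rewrite ?mem_rev mem_filter => /andP[].
  rewrite /level => lab; have : (0 < hue_height M b)%N.
    by move: lab (ltn_ord b); case: (hue_height M b) ha => //; case: (hue_height M a) => // n; rewrite mulSn; lia.
  by case/hue_height_attained => t [tM tb _]; exists t => //; move: tM; rewrite mem_filter => /andP[].
have := costly_sum (s := s) (A := predT) (u := fun b => x ^+ b) (fun b _ => every_hue b).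
have S := subrX1 x c; have cub := base_cubic x1 xc (ltnW c2).
rewrite -natr1 in psN.
(* The new point leaves room for at most [x ^ c - 1] earlier ones. *)
have {ws} : x ^+ 2 * (total_weight s)%:R <= x ^+ 2 * (x ^+ c - 1).
  by rewrite ler_pM2l ?exprn_gt0 // lerBrDr (le_trans _ psN) // lerD2r ler_nat.
rewrite S /=; set T := \sum_(i < c) _ => le1 le2.
have T0 : 0 < T.
  by rewrite -(pmulr_rgt0 _ (_ : 0 < x - 1)) ?subr_gt0 // -S subr_gt0 exprn_egt1 //; lia.
have : x ^+ 2 * (x - 1) * T < 1 * T by rewrite ltr_pM2r.
by lra.
Qed.

Lemma greedy_avoids_pairs (a0 : 'I_c) :
  (2 < c)%N -> avoids_mono_wedges (greedy a0) (x ^+ c) 2.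
Proof.
move=> c2 ps _ psN; apply: never_mono_wedge_heights => // i q.
rewrite ltnS; apply: heights_le1 => //; apply: le_trans psN.
by rewrite ler_nat size_take; case: ltnP => // /ltnW.
Qed.

End Cost.

End Staircase.

(** Room is left over: [c * (k - 2) + 1] plus the 2 from the factor [x ^ 2] is
    less than [c * (k - 1)] as soon as [3 < c]. *)
Lemma avoids_of_admissible (R : realType) (x : R) (c k : nat) :
  1 < x -> (4 <= c)%N -> (0 < k)%N -> admissible x c ->
  exists alg : online_alg R c,
    avoids_mono_wedges alg (x ^ (c%:Z * (k%:Z - 2) + 1)) k.
Proof.
move=> x1 c4; case: k => [//|k] _ adm.
have c0 : (0 < c)%N by lia.
exists (greedy (Ordinal c0)); apply: (greedy_avoids x1 adm) => //; first lia.
have x0 : x != 0 by rewrite gt_eqF // (lt_trans _ x1).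
rewrite -[x ^+ 2]/(x ^ 2%:Z) -expfzDr // -[x ^+ (c * k)]/(x ^ (c * k)%:Z).
by rewrite ltr_eXz2l //; lia.
Qed.

Theorem theorem5 (R : realType) :
  [/\ (forall k : nat, (0 < k)%N -> forall c : nat, (4 <= c)%N ->
        exists alg : online_alg R c,
          avoids_mono_wedges alg
            ((122074%:R / 10 ^+ 5) ^ (c%:Z * (k%:Z - 2) + 1)) k),
      (exists c0 : nat, forall k : nat, (0 < k)%N ->
        forall c : nat, (c0 <= c)%N ->
        exists alg : online_alg R c,
          avoids_mono_wedges alg
            ((146557%:R / 10 ^+ 5) ^ (c%:Z * (k%:Z - 2) + 1)) k)
    & (exists c1 : nat, forall c : nat, (c1 <= c)%N ->
        exists alg : online_alg R c,
          avoids_mono_wedges alg ((146557%:R / 10 ^+ 5) ^+ c) 2)].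
Proof.
have x1 : (1 : R) < 122074%:R / 10 ^+ 5 by lra.
have y1 : (1 : R) < 146557%:R / 10 ^+ 5 by lra.
split.
- by move=> k k0 c c4; apply: (avoids_of_admissible x1 c4 k0 (admissible_small R c4)).
- exists 38%N => k k0 c c38; have c4 : (4 <= c)%N by apply: leq_trans c38.
  exact: (avoids_of_admissible y1 c4 k0 (admissible_large R c38)).
- exists 38%N => c c38; have c0 : (0 < c)%N by apply: leq_trans c38.
  have c2 : (2 < c)%N by apply: leq_trans c38.
  exists (greedy (Ordinal c0)).
  exact: (greedy_avoids_pairs y1 (admissible_large R c38) c2).
Qed.
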